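(* Let $G$ be a finite loopless graph. The R-cocore of $G$ is unique up to isomorphism; that is, any two R-cocores of $G$ are isomorphic.
   Context: Graphs are finite and undirected. For a finite set $B$ and a relation $R\subseteq V_H\times B$ with full image (every $b\in B$ has some $v$ with $(v,b)\in R$), $H\ast R$ is the graph with vertex set $B$ and edge set $\{(a,b)\in B\times B: \exists (u,v)\in E_H,\ (u,a)\in R,\ (v,b)\in R\}$. All relations here are required to have full domain. For an induced subgraph $H$ of $G$, an R-coretraction of $H$ to $G$ is a relation $R\subseteq V_H\times V_G$ with $H\ast R=G$ and $(x,x)\in R$ for all $x\in V_H$; in this case $H$ is called an R-coretract of $G$. An R-cocore of $G$ is an R-coretract $H$ of $G$ such that no proper induced subgraph of $H$ is an R-coretract of $H$. *)

(* Defs.v *)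
From mathcomp Require Import all_boot.

Set Implicit Arguments.
Unset Strict Implicit.
Unset Printing Implicit Defensive.

(* Finite undirected graphs without multiple edges; loops [edge x x] are
   allowed, and excluded by [loopless]. *)
Record graph := Graph {
  vertex :> finType;
  edge : rel vertex;
  edge_sym : symmetric edge
}.

Definition loopless (G : graph) : Prop := irreflexive (edge (g := G)).

Definition induced_edge (G : graph) (A : {set G}) : rel {x : G | x \in A} :=
  fun x y => edge (val x) (val y).

Lemma induced_edge_sym (G : graph) (A : {set G}) : symmetric (induced_edge (A := A)).
Proof. by move=> x y; rewrite /induced_edge edge_sym. Qed.

Definition induced (G : graph) (A : {set G}) : graph :=
  Graph (@induced_edge_sym G A).

Definition isomorphic (G H : graph) : Prop :=
  exists2 f : G -> H, bijective f & forall x y, edge (f x) (f y) = edge x y.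

Definition full_domain (A B : finType) (R : {set A * B}) : Prop :=
  forall a, exists b, (a, b) \in R.

Definition full_image (A B : finType) (R : {set A * B}) : Prop :=
  forall b, exists a, (a, b) \in R.

Definition star_edge (H : graph) (B : finType) (R : {set H * B}) : rel B :=
  fun a b => [exists u, exists v, [&& edge u v, (u, a) \in R & (v, b) \in R]].

Lemma star_edge_sym (H : graph) (B : finType) (R : {set H * B}) :
  symmetric (star_edge R).
Proof.
suff imp a b : star_edge R a b -> star_edge R b a by move=> a b; apply/idP/idP; apply: imp.
case/existsP=> u /existsP[v /and3P[uv ua vb]].
by apply/existsP; exists v; apply/existsP; exists u; rewrite edge_sym uv ua vb.
Qed.

(* The graph H * R, meaningful when [R] has full image; this requirement is
   part of [coretraction]. *)
Definition star (H : graph) (B : finType) (R : {set H * B}) : graph :=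
  Graph (star_edge_sym R).

(* H * R and G have the same vertex type, so H * R = G, an equality on the
   nose and not up to isomorphism, amounts to equality of edge relations. *)
Definition coretraction (G : graph) (A : {set G}) (R : {set induced A * G}) : Prop :=
  [/\ full_domain R, full_image R,
      edge (g := star R) =2 edge (g := G)
    & forall x : induced A, (x, val x) \in R].

Definition coretract (G : graph) (A : {set G}) : Prop :=
  exists R : {set induced A * G}, coretraction R.

(* An induced subgraph is given by its vertex set; the proper ones are those
   whose vertex set is not everything. *)
Definition cocore (G : graph) (A : {set G}) : Prop :=
  coretract A /\
  forall B : {set induced A}, B \proper [set: induced A] -> ~ coretract B.

(* Main.v *)
(* A set A is a coretract of G exactly when every neighbourhood N(b) is the
   union of a nonempty family of neighbourhoods N(u) with u in A; in a cocore
   A, moreover, no N(x) with x in A is such a union over A minus x. Writing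
   N(x), for x in one cocore, as a union over another cocore and then each
   term again as a union over the first, x has to occur, so some y of the
   second cocore satisfies N(y) = N(x). This pairing of vertices with equal
   neighbourhoods is the isomorphism. *)
Require Import Defs.
From mathcomp Require Import all_boot.

Definition nbhd {G : graph} (x : G) : {set G} := [set y | edge x y].

(** The first clause keeps the family nonempty even for an isolated [b], as full image demands. *)
Definition covered {G : graph} (A : {set G}) (b : G) : Prop :=
  (exists2 u, u \in A & nbhd u \subset nbhd b) /\
  (forall y, edge b y ->
     exists u, [/\ u \in A, nbhd u \subset nbhd b & edge u y]).

Lemma nbhd_subP {G : graph} {x y : G} :
  reflect (forall z, edge x z -> edge y z) (nbhd x \subset nbhd y).
Proof.
apply: (iffP subsetP) => sub z; last by rewrite !inE; apply: sub.
by move=> xz; move: (sub z); rewrite !inE => ->.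
Qed.

Lemma coretract_covered {G : graph} {A : {set G}} :
  coretract A <-> forall b, covered A b.
Proof.
split=> [[R [_ fullR edgeR diagR]] b | covA].
  have R_sub (u : induced A) c : (u, c) \in R -> nbhd (val u) \subset nbhd c.
    move=> uRc; apply/nbhd_subP => z; rewrite -!edgeR.
    case/existsP=> u1 /existsP[v /and3P[u1v u1Ru vRz]].
    apply/existsP; exists u; apply/existsP; exists v; rewrite uRc vRz /= andbT.
    (* The diagonal pair at [v] turns the edge from [v] to [u1] into one from [v] to [u]. *)
    have: edge (val v) (val u).
      rewrite -edgeR; apply/existsP; exists v; apply/existsP; exists u1.
      by rewrite diagR u1Ru edge_sym u1v.
    by rewrite /induced_edge edge_sym.
  split=> [|y].
    have [u uRb] := fullR b; exists (val u); [exact: valP | exact: R_sub].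
  rewrite -edgeR => /existsP[u /existsP[v /and3P[uv uRb vRy]]].
  exists (val u); split; [exact: valP | exact: R_sub |].
  rewrite -edgeR; apply/existsP; exists u; apply/existsP; exists v.
  by rewrite uv diagR vRy.
(* By the inclusion just proved for coretractions, this is the largest candidate relation. *)
exists [set p : induced A * G | nbhd (val p.1) \subset nbhd p.2]; split.
- by move=> u; exists (val u); rewrite inE.
- by move=> b; have [[u uA ub] _] := covA b; exists (Sub u uA); rewrite inE.
- move=> a b; apply/existsP/idP => [[u /existsP[v /and3P[uv]]] | ab].
    rewrite !inE /= => /nbhd_subP ua /nbhd_subP vb.
    by rewrite edge_sym vb // edge_sym ua.
  (* Covering [a] moves one end of the edge into [A]; covering [b] at its new neighbour [u] moves
     the other. *)
  have [u [uA ua ub]] := (covA a).2 b ab.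
  have bu : edge (g := G) b u by rewrite edge_sym.
  have [v [vA vb vu]] := (covA b).2 u bu.
  exists (Sub u uA); apply/existsP; exists (Sub v vA).
  by rewrite !inE ua vb /= /induced_edge /= edge_sym vu.
- by move=> x; rewrite inE.
Qed.

(** Otherwise deleting [x] leaves a coretract of [induced A]: every other vertex covers itself, and
    inclusions of neighbourhoods in [G] restrict to [A]. *)
Lemma cocore_irredundant {G : graph} {A : {set G}} {x : G} :
  cocore A -> x \in A -> ~ covered (A :\ x) x.
Proof.
move=> [_ minA] xA [[u0 u0Ax u0x] covx].
have induced_sub (u v : induced A) :
    nbhd (val u) \subset nbhd (val v) -> nbhd u \subset nbhd v.
  by move=> /nbhd_subP uv; apply/nbhd_subP => z; apply: uv.
pose x' : induced A := Sub x xA.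
apply: (minA [set~ x']).
  by rewrite properT; apply/eqP => /setP/(_ x'); rewrite !inE eqxx.
apply/coretract_covered => b.
have [-> | bx] := eqVneq b x'; last first.
  by split=> [|y yb]; exists b; rewrite ?inE.
split=> [|y xy].
  move: u0Ax; rewrite !inE => /andP[u0nx u0A].
  by exists (Sub u0 u0A); [rewrite !inE -val_eqE | apply: induced_sub].
have [u []] := covx (val y) xy.
rewrite !inE => /andP[unx uA] ux uy.
by exists (Sub u uA); split; [rewrite !inE -val_eqE | apply: induced_sub |].
Qed.

(** A second vertex of [A] with the neighbourhood of [x] would cover [x] by itself. *)
Lemma cocore_nbhd_inj {G : graph} {A : {set G}} :
  cocore A -> {in A &, injective (@nbhd G)}.
Proof.
move=> cA x y xA yA xy; apply/eqP/negPn/negP => nxy.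
have yAx : y \in A :\ x by rewrite !inE eq_sym nxy.
apply: (cocore_irredundant cA xA); split=> [|z xz]; exists y; rewrite ?xy //.
by split=> //; have /setP/(_ z) := xy; rewrite !inE xz => <-.
Qed.

Lemma cocore_twin {G : graph} {A B : {set G}} {x : G} :
  cocore A -> coretract B -> x \in A -> exists2 y, y \in B & nbhd y = nbhd x.
Proof.
move=> cA /coretract_covered covB xA.
have /coretract_covered covA := cA.1.
have [/exists_inP[y yB /eqP yx] | ] := boolP [exists y in B, nbhd y == nbhd x].
  by exists y.
rewrite negb_exists_in => /forall_inP noB; exfalso.
(* If [u] were [x], the two inclusions would make [y] a twin of [x]. *)
have refine y u : y \in B -> nbhd y \subset nbhd x ->
    u \in A -> nbhd u \subset nbhd y -> u \in A :\ x.
  move=> yB yx uA uy; rewrite !inE uA andbT.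
  apply: contraNneq (noB y yB) => ux.
  by rewrite eqEsubset yx -ux uy.
apply: (cocore_irredundant cA xA); split=> [|z xz].
  have [[y yB yx] _] := covB x; have [[u uA uy] _] := covA y.
  by exists u; [exact: refine uA uy | exact: subset_trans yx].
have [y [yB yx yz]] := (covB x).2 z xz.
have [u [uA uy uz]] := (covA y).2 z yz.
by exists u; split; [exact: refine uA uy | exact: subset_trans yx |].
Qed.

Lemma cocore_twin_map {G : graph} {A B : {set G}} :
  cocore A -> coretract B ->
  exists f : induced A -> induced B, forall x, nbhd (val (f x)) = nbhd (val x).
Proof.
move=> cA rB.
have ex (x : induced A) : exists y : induced B, nbhd (val y) == nbhd (val x).
  have [y yB yx] := cocore_twin cA rB (valP x).
  by exists (Sub y yB); apply/eqP.
by exists (fun x => xchoose (ex x)) => x; apply/eqP/(xchooseP (ex x)).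
Qed.

Theorem proposition4p4p14 (G : graph) (hG : loopless G) (A B : {set G})
  (hA : cocore A) (hB : cocore B) : isomorphic (induced A) (induced B).
Proof.
have [f fN] := cocore_twin_map hA hB.1.
have [g gN] := cocore_twin_map hB hA.1.
exists f.
  exists g => x; apply: val_inj.
    by apply: (cocore_nbhd_inj hA); rewrite ?gN ?fN //; apply: valP.
  by apply: (cocore_nbhd_inj hB); rewrite ?fN ?gN //; apply: valP.
(* Adjacency depends only on neighbourhoods, so the endpoints can be replaced one at a time. *)
have edgeN (u v w : G) : nbhd u = nbhd v -> edge u w = edge v w.
  by move=> /setP/(_ w); rewrite !inE.
move=> x y; rewrite /= /induced_edge (edgeN _ _ _ (fN x)).
by rewrite edge_sym (edgeN _ _ _ (fN y)) edge_sym.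
Qed.
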